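(* Let $\mathbf A$ be a square matrix of size $n$ with entries in $\{0,L,A,M\}$, and let $\mathbf B=\bigcup_{i}\mathbf A^i$ be its union closure (union over all $i\ge0$). Then $\mathbf B=\bigcup_{i<n^2}\mathbf A^i$; that is, the union closure can be calculated by considering just the first $n^2$ matrix powers.
   Context: The set $\{0,L,A,M\}$ is ordered by $0<L<A<M$. Union $\cup$ is the maximum. Sum: $0$ is neutral, $L+L=A$, and otherwise $x+y=\max(x,y)$. Product: $0\times x=x\times0=0$, $L\times x=x\times L=x$, and $x\times y=\max(x,y)$ for $x,y\in\{A,M\}$. Matrix product is $(\mathbf A\times\mathbf B)_{i,j}=\sum_k\mathbf A_{i,k}\times\mathbf B_{k,j}$ with these operations, union of matrices is entrywise, and $\mathbf A^0=\mathbf I$ is the matrix with $L$ on the diagonal and $0$ elsewhere.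
   Formalization: The claim with i < n^2 is false for n = 1 (A = (M)) and n = 2 (A = [0 L; L L]); it is proved for every other n, and for every n, including 1 and 2, the union over i ≤ n^2 is proved to equal B. *)

(* Defs.v *)
From HB Require Import structures.
From mathcomp Require Import all_boot all_order all_algebra.
From mathcomp Require Import boolp classical_sets.

Set Implicit Arguments.
Unset Strict Implicit.
Unset Printing Implicit Defensive.

Import Order.TTheory GRing.Theory.

(* The constructors stand for 0, L, A and M. *)
Inductive dep : Set := D0 | DL | DA | DM.

Definition dep_rank (x : dep) : nat :=
  match x with D0 => 0 | DL => 1 | DA => 2 | DM => 3 end.

Definition dep_unrank (k : nat) : dep := nth D0 [:: D0; DL; DA; DM] k.

Lemma dep_rankK : cancel dep_rank dep_unrank.
Proof. by case. Qed.

HB.instance Definition _ := Countable.copy dep (can_type dep_rankK).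

Fact dep_enumP : Finite.axiom [:: D0; DL; DA; DM].
Proof. by case. Qed.

HB.instance Definition _ := isFinite.Build dep dep_enumP.

Fact dep_display : Order.disp_t. Proof. exact: Order.Disp tt tt. Qed.

Definition dep_le (x y : dep) : bool := (dep_rank x <= dep_rank y)%N.
Definition dep_lt (x y : dep) : bool := (y != x) && dep_le x y.
Definition dep_min (x y : dep) : dep := if dep_lt x y then x else y.
Definition dep_max (x y : dep) : dep := if dep_lt x y then y else x.

Fact dep_le_anti : antisymmetric dep_le.
Proof.
move=> x y; rewrite /dep_le -eqn_leq => /eqP.
exact: (can_inj dep_rankK).
Qed.

Fact dep_le_trans : transitive dep_le.
Proof. by move=> y x z; exact: leq_trans. Qed.

Fact dep_le_total : total dep_le.
Proof. by move=> x y; exact: leq_total. Qed.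

HB.instance Definition _ := Order.isOrder.Build dep_display dep
  (fun _ _ => erefl) (fun _ _ => erefl) (fun _ _ => erefl)
  dep_le_anti dep_le_trans dep_le_total.

Fact dep_le0x (x : dep) : (D0 <= x)%O.
Proof. by []. Qed.

HB.instance Definition _ := Order.hasBottom.Build dep_display dep dep_le0x.

Definition dep_add (x y : dep) : dep :=
  match x, y with
  | D0, z | z, D0 => z
  | DL, DL => DA
  | _, _ => Order.max x y
  end.

Definition dep_mul (x y : dep) : dep :=
  match x, y with
  | D0, _ | _, D0 => D0
  | DL, z | z, DL => z
  | _, _ => Order.max x y
  end.

Fact dep_addA : associative dep_add. Proof. by do ?case. Qed.
Fact dep_addC : commutative dep_add. Proof. by do ?case. Qed.
Fact dep_add0 : left_id D0 dep_add. Proof. by case. Qed.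
Fact dep_mulA : associative dep_mul. Proof. by do ?case. Qed.
Fact dep_mul1l : left_id DL dep_mul. Proof. by case. Qed.
Fact dep_mul1r : right_id DL dep_mul. Proof. by case. Qed.
Fact dep_mulDl : left_distributive dep_mul dep_add.
Proof. by do ?case. Qed.
Fact dep_mulDr : right_distributive dep_mul dep_add.
Proof. by do ?case. Qed.
Fact dep_mul0l : left_zero D0 dep_mul. Proof. by case. Qed.
Fact dep_mul0r : right_zero D0 dep_mul. Proof. by case. Qed.
Fact dep_1neq0 : DL != D0. Proof. by apply/eqP. Qed.

(* The ring constants are 0 = D0 and 1 = DL, so the library's matrix product,
   identity matrix and powers on 'M[dep]_n use the operations above, with DL on
   the diagonal of the identity. *)
HB.instance Definition _ := GRing.isNzSemiRing.Build dep
  dep_addA dep_addC dep_add0 dep_mulA dep_mul1l dep_mul1r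
  dep_mulDl dep_mulDr dep_mul0l dep_mul0r dep_1neq0.

Local Open Scope ring_scope.

Definition cupmx (m n : nat) (A B : 'M[dep]_(m, n)) : 'M[dep]_(m, n) :=
  \matrix_(i, j) Order.max (A i j) (B i j).

(* Union of an infinite family. The order on dep is finite with a bottom, so
   each supremum exists and is the maximum of the values taken. *)
Definition bigcupmx (m n : nat) (F : nat -> 'M[dep]_(m, n)) : 'M[dep]_(m, n) :=
  \matrix_(i, j) supremum (\bot%O : dep) (range (fun k => F k i j)).

Definition union_closure (n : nat) (A : 'M[dep]_n) : 'M[dep]_n :=
  bigcupmx (fun k => A ^+ k).

(* Main.v *)
(** Entry [(i, j)] of [A ^+ k] is at least [v] exactly when the row vector
    [e_i *m A ^+ k] is at least [v] in coordinate [j].  Such an inequality only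
    needs one of three kinds of witness vectors at each step: [e_u] (the value
    [v] is still to be produced), [v *: e_u] (it has been produced), or
    [e_p + e_q] with [p != q] (two distinct walks of value [L], which give [A]
    where they meet again).  A chain of witnesses can be shortened until it has
    no repetition, so its length is less than [n + n + 'C(n, 2)]; this is at
    most [n ^ 2] for [n >= 3] and at most [n ^ 2 + 1] always. *)
Require Import Defs.
From mathcomp Require Import all_boot all_order all_algebra.
From mathcomp Require Import boolp classical_sets.
From mathcomp Require Import zify.

Set Implicit Arguments.
Unset Strict Implicit.
Unset Printing Implicit Defensive.

Import Order.TTheory GRing.Theory.

Local Open Scope ring_scope.

Lemma le_depD (x x' y y' : dep) :
  (x <= x' -> y <= y' -> x + y <= x' + y')%O.
Proof. by case: x; case: x'; case: y; case: y'. Qed.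

Lemma le_depM (x x' y y' : dep) :
  (x <= x' -> y <= y' -> x * y <= x' * y')%O.
Proof. by case: x; case: x'; case: y; case: y'. Qed.

(** On nonzero elements the product is the maximum, so one factor alone reaches [v]. *)
Lemma le_depMP (v x y : dep) : v != 0 -> (v <= x * y)%O ->
  (v <= x)%O && (DL <= y)%O || (DL <= x)%O && (v <= y)%O.
Proof. by case: v; case: x; case: y. Qed.

(** A sum exceeds the maximum of its terms only through [DL + DL = DA]. *)
Lemma le_depDP (v x y : dep) : (v <= x + y)%O ->
  [\/ (v <= x)%O, (v <= y)%O | [/\ v = DA, x != 0 & y != 0]].
Proof.
by case: v; case: x; case: y => // _;
  first [exact: Or31 | exact: Or32 | exact: Or33].
Qed.

Lemma dep_le0 (x : dep) : (D0 <= x)%O.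
Proof. by case: x. Qed.

Lemma le_dep_sumP (I : finType) (v : dep) (F : I -> dep) : v != 0 ->
  (v <= \sum_i F i)%O ->
  (exists i, v <= F i)%O \/
  v = DA /\ exists p q, [/\ p != q, F p != 0 & F q != 0].
Proof.
move=> v0; rewrite -big_enum; have := enum_uniq I; move: (enum I) => s.
have sum_neq0 (r : seq I) :
    \sum_(i <- r) F i != 0 -> exists2 i, i \in r & F i != 0.
  elim: r => [|a r IH]; first by rewrite big_nil eqxx.
  rewrite big_cons; have [Fa0|Fa _] := eqVneq (F a) 0; last first.
    by exists a => //; rewrite inE eqxx.
  by rewrite Fa0 add0r => /IH[i ir Fi]; exists i => //; rewrite inE ir orbT.
elim: s => [_|a s IH /= /andP[as_ us]].
  by rewrite big_nil => v_le0; case: v v0 v_le0.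
rewrite big_cons => /le_depDP[vFa|/(IH us)//|[-> Fa /sum_neq0[i si Fi]]].
  by left; exists a.
right; split=> //; exists a, i; split=> //.
by apply: contraNneq as_ => ->.
Qed.

Lemma le_dep_sum (I : finType) (F G : I -> dep) :
  (forall i, F i <= G i)%O -> (\sum_i F i <= \sum_i G i)%O.
Proof.
by move=> FG; apply: (big_ind2 (fun x y : dep => (x <= y)%O)) => // *;
  apply: le_depD.
Qed.

Definition lerow (n : nat) (x y : 'rV[dep]_n) : bool :=
  [forall u, (x 0 u <= y 0 u)%O].

Lemma lerow_trans (n : nat) : transitive (@lerow n).
Proof.
move=> y x z /forallP xy /forallP yz; apply/forallP => u.
exact: le_trans (xy u) (yz u).
Qed.

Lemma lerow_mulmx (n m : nat) (x y : 'rV[dep]_n) (A : 'M_(n, m)) :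
  lerow x y -> lerow (x *m A) (y *m A).
Proof.
move=> /forallP xy; apply/forallP => u; rewrite !mxE.
by apply: le_dep_sum => i; apply: le_depM.
Qed.

Definition row1 (n : nat) (v : dep) (u : 'I_n) : 'rV[dep]_n :=
  \row_w (if w == u then v else 0).

Definition row_ind (n : nat) (B : {set 'I_n}) : 'rV[dep]_n :=
  \row_w (if w \in B then 1 else 0).

Definition witnesses (n : nat) (v : dep) : {set 'rV[dep]_n} :=
  (row1 1 @: [set: 'I_n]) :|: (row1 v @: [set: 'I_n]) :|:
  (@row_ind n @: [set B : {set 'I_n} | #|B| == 2%N]).

Lemma card_witnesses (n : nat) (v : dep) :
  (#|witnesses n v| <= n + n + 'C(n, 2))%N.
Proof.
apply: leq_trans (leq_card_setU _ _) _; apply: leq_add.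
  apply: leq_trans (leq_card_setU _ _) _.
  by apply: leq_add; apply: leq_trans (leq_imset_card _ _) _;
    rewrite cardsT card_ord.
by apply: leq_trans (leq_imset_card _ _) _; rewrite card_draws card_ord.
Qed.

Lemma row1_mulmx (n m : nat) (v : dep) (u : 'I_n) (A : 'M_(n, m)) j :
  (row1 v u *m A) 0 j = v * A u j.
Proof.
rewrite mxE (bigD1 u) //= mxE eqxx big1 ?addr0 // => i /negbTE iu.
by rewrite mxE iu mul0r.
Qed.

Lemma lerow_row1 (n : nat) (v : dep) (u : 'I_n) (z : 'rV_n) :
  (v <= z 0 u)%O -> lerow (row1 v u) z.
Proof.
move=> vz; apply/forallP => w; rewrite mxE.
by case: eqP => [->//|_]; apply: dep_le0.
Qed.

(** The three kinds of witness match the cases for the sum: one term reaches [v] through [z], or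
    through [W], or two nonzero terms add up to [DA]. *)
Lemma witness_exists (n m : nat) (v : dep) (z : 'rV[dep]_n) (W : 'M_(n, m)) j :
    v != 0 -> (v <= (z *m W) 0 j)%O ->
  exists y, [/\ y \in witnesses n v, lerow y z & (v <= (y *m W) 0 j)%O].
Proof.
move=> v0; rewrite mxE.
case/(le_dep_sumP v0) => [[u /(le_depMP v0)/orP[]/andP[vz vW]]|].
- exists (row1 v u); split; last 1 first.
  + by rewrite row1_mulmx -{1}[v]mulr1; apply: le_depM.
  + by rewrite !inE imset_f ?orbT.
  + exact: lerow_row1.
- exists (row1 1 u); split; last 1 first.
  + by rewrite row1_mulmx mul1r.
  + by rewrite !inE imset_f.
  + exact: lerow_row1.
move=> [-> [p [q [pq zWp zWq]]]].
have nz0 (x y : dep) : x * y != 0 -> (DL <= x)%O /\ (DL <= y)%O.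
  by case: x; case: y.
have [zp Wp] := nz0 _ _ zWp; have [zq Wq] := nz0 _ _ zWq.
exists (row_ind [set p; q]); split.
- by rewrite !inE imset_f ?orbT // inE cards2 pq.
- apply/forallP => w; rewrite mxE !inE.
  case: eqP => [->|_] /=; first by [].
  by case: eqP => [->|_]; [|apply: dep_le0].
rewrite mxE (bigD1 p) //= (bigD1 q) ?(eq_sym q) //= !mxE !inE !eqxx orbT !mul1r.
(* The two units bound the terms at [p] and [q], the zero bounds all the others. *)
have -> : DA = 1 + (1 + 0) :> dep by [].
by apply: le_depD => //; apply: le_depD => //; apply: dep_le0.
Qed.

Definition step (n : nat) (v : dep) (A : 'M[dep]_n) : rel 'rV[dep]_n :=
  fun x y => (y \in witnesses n v) && lerow y (x *m A).

(** Converts a chain, even after shortening, back into a bound on the power given by its length. *)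
Lemma step_path_le (n : nat) (v : dep) (A : 'M[dep]_n) (x : 'rV_n) p :
  path (step v A) x p -> lerow (last x p) (x *m A ^+ size p).
Proof.
elim: p x => [|y p IH] x /=.
  by move=> _; rewrite expr0 mulmx1; apply/forallP.
move=> /andP[/andP[_ yx] /IH h]; apply: lerow_trans h _.
by rewrite exprS -mulmxE mulmxA; apply: lerow_mulmx.
Qed.

Lemma step_path_exists (n : nat) (v : dep) (A : 'M[dep]_n) (x : 'rV_n) k j :
    v != 0 -> (v <= (x *m A ^+ k) 0 j)%O ->
  exists2 p, path (step v A) x p & (v <= last x p 0 j)%O.
Proof.
move=> v0; elim: k x => [|k IH] x.
  by rewrite expr0 mulmx1 => ?; exists [::].
rewrite exprS -mulmxE mulmxA => /(witness_exists v0)[y [yW yx /IH[p yp jp]]].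
by exists (y :: p) => //=; rewrite /step yW yx.
Qed.

Lemma short_power (n : nat) (A : 'M[dep]_n) (i j : 'I_n) (k : nat) :
  exists2 l, (l < n + n + 'C(n, 2))%N & ((A ^+ k) i j <= (A ^+ l) i j)%O.
Proof.
have [->|v0] := eqVneq ((A ^+ k) i j) 0.
  (* The index [i] rules out [n = 0], so the bound is positive. *)
  by exists 0%N; [case: n i {A j} => [[]|] | apply: dep_le0].
set v := (A ^+ k) i j in v0 *.
have: (v <= (row1 1 i *m A ^+ k) 0 j)%O by rewrite row1_mulmx mul1r.
(* Cutting out loops keeps both endpoints, hence the value reached at [j]. *)
case/(step_path_exists v0) => p /shortenP[q xq uq _] vq.
exists (size q); last first.
  rewrite -[leRHS]mul1r -row1_mulmx; apply: le_trans vq _.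
  by have /forallP := step_path_le xq; apply.
(* The start is itself a witness, so the chain has [(size q).+1] distinct witnesses; this gives the
   strict bound. *)
apply: leq_trans (card_witnesses n v).
rewrite -[(size q).+1]/(size (row1 1 i :: q)) -(card_uniqP uq).
apply/subset_leq_card/fintype.subsetP => y; rewrite inE => /predU1P[->|].
  by rewrite !inE imset_f.
move: (row1 1 i) xq {uq vq} => x.
elim: q x => //= a q IH x /andP[/andP[aW _] /IH h].
by rewrite inE => /predU1P[->|].
Qed.

Lemma big_cupmxE (n m N : nat) (F : nat -> 'M[dep]_(n, m)) i j :
  (\big[@cupmx n m/0]_(k < N) F k) i j =
  \big[Order.max/D0]_(k < N) F k i j.
Proof.
by apply: (big_morph (fun B : 'M_(n, m) => B i j)) => [B C|]; rewrite mxE.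
Qed.

Lemma union_closure_bounded (n N : nat) (A : 'M[dep]_n) :
  (n + n + 'C(n, 2) <= N)%N ->
  union_closure A = \big[@cupmx n n/0]_(k < N) A ^+ k.
Proof.
move=> leN; apply/matrixP => i j; rewrite big_cupmxE mxE.
set S := (X in supremum _ X); set m := (RHS).
have Sm : supremums S m.
  split=> [_ [k _ <-]|b ub].
    have [l lN kl] := short_power A i j k; apply: le_trans kl _.
    exact: (le_bigmax _ (fun k : 'I_N => (A ^+ k) i j)
              (Ordinal (leq_trans lN leN))).
  by apply: bigmax_le => [|k _]; [exact: le0x | apply: ub; exists (k : nat)].
have S0 : (S !=set0)%classic by exists ((A ^+ 0) i j); exists 0%N.
(* [supremum] takes a default on the empty set and otherwise chooses some supremum, which by
   uniqueness is [m]. *)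
rewrite /supremum; case: eqP => [S00|_]; first by case: S0; rewrite S00.
by case: xgetP => [y _ Sy|/(_ m)//]; apply: is_subset1_supremums Sy Sm.
Qed.

(* The strict bound i < n ^ 2 fails for the sizes 1 (A = [M]) and
   2 (A = [0 L; L L]); there the powers up to A ^+ (n ^ 2) are needed. *)
Theorem theorem20 (n : nat) (A : 'M[dep]_n) :
  (n != 1%N -> n != 2%N ->
     union_closure A = \big[@cupmx n n/0]_(i < n ^ 2) A ^+ i) /\
  union_closure A = \big[@cupmx n n/0]_(i < (n ^ 2).+1) A ^+ i.
Proof.
have binE : ('C(n, 2).*2 + n = n ^ 2)%N.
  by rewrite bin2 halfK oddM; case: n {A} => //= m; rewrite andNb subn0; lia.
(* Doubled, the bounds read [n ^ 2 + 3 * n <= 2 * n ^ 2], true for [n = 0] and [n >= 3], and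
   [0 <= (n - 1) * (n - 2)] over the integers, always true. *)
split=> [n1 n2|]; apply: union_closure_bounded; nia.
Qed.
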